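(* Let $X$ be a connected, simply connected, locally path-connected metric space. Let $\Omega=(\Omega_1,\ldots,\Omega_q)$ be a collection of pairwise disjoint non-empty open sets such that $\bigcup_{i=1}^q\overline{\Omega_i}=X$, and assume that for every $i\in[q]=\{1,\ldots,q\}$, $\Omega_i$ is connected and $\Omega_i=\operatorname{int}\overline{\Omega_i}$. For $K\subset[q]$ write $\bar\Omega_K:=\bigcup_{i\in K}\overline{\Omega_i}$. If $\Sigma=\bigcup_{i\in[q]}\partial\Omega_i$ is disconnected, then there exists a partition of $[q]$ into three pairwise disjoint non-empty sets $I$, $\{\ell\}$, $J$ such that $X$ is the disjoint union of $\bar\Omega_I$, $\Omega_\ell$ and $\bar\Omega_J$, and $\partial\Omega_\ell$ is the disjoint union of the two non-empty sets $\partial\bar\Omega_I$ and $\partial\bar\Omega_J$. *)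

(* Defs.v *)
From HB Require Import structures.
From mathcomp Require Import all_boot all_order all_algebra.
From mathcomp Require Import all_classical all_reals all_analysis.
Set Implicit Arguments. Unset Strict Implicit. Unset Printing Implicit Defensive.
Import Order.TTheory GRing.Theory Num.Theory.
Import numFieldNormedType.Exports.
Local Open Scope classical_set_scope.
Local Open Scope ring_scope.

Section Defs.
Context {R : realType} {X : topologicalType}.

Definition boundary (A : set X) : set X := closure A `\` A°.

Definition is_path_in (A : set X) (g : R -> X) (a b : X) : Prop :=
  {within `[0, 1], continuous g} /\ g 0 = a /\ g 1 = b /\ g @` `[0, 1] `<=` A.

Definition path_connected_set (A : set X) : Prop :=
  forall a b, A a -> A b -> exists g : R -> X, is_path_in A g a b.

Definition locally_path_connected : Prop :=
  forall (x : X) (U : set X), nbhs x U ->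
    exists V : set X, [/\ nbhs x V, V `<=` U & path_connected_set V].

Definition null_homotopic_loop (g : R -> X) : Prop :=
  exists H : (R * R)%type -> X,
    [/\ {within `[0, 1] `*` `[0, 1], continuous H},
        (forall s, s \in `[0, 1] -> H (s, 0) = g s),
        (forall s, s \in `[0, 1] -> H (s, 1) = g 0) &
        (forall t, t \in `[0, 1] -> H (0, t) = g 0 /\ H (1, t) = g 0)].

Definition simply_connected : Prop :=
  path_connected_set setT /\
  forall g : R -> X, {within `[0, 1], continuous g} -> g 0 = g 1 ->
    null_homotopic_loop g.

End Defs.

Arguments simply_connected R X : clear implicits.
Arguments locally_path_connected R X : clear implicits.

Definition OmegaBar {X : topologicalType} {q : nat} (Om : 'I_q -> set X)
  (K : {set 'I_q}) : set X :=
  [set x | exists2 i, i \in K & closure (Om i) x].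

(* Main.v *)
Require Import Defs.
From HB Require Import structures.
From mathcomp Require Import all_boot all_order all_algebra.
From mathcomp Require Import all_classical all_reals all_analysis.
From mathcomp Require Import zify ring lra.
Import Order.TTheory GRing.Theory Num.Theory.
Import numFieldNormedType.Exports.
Local Open Scope classical_set_scope.
Local Open Scope ring_scope.

(* If every complement of a tile were connected, each boundary of a tile would be
   connected (unicoherence of X); grouping the tiles according to the part of a
   separation of Sigma containing their boundary would then disconnect X.  Hence
   some X \ Om_l is disconnected, and a separation of it gives I and J.

   Unicoherence reduces to the following: if X is covered by open sets U and V
   with U /\ V the union of disjoint open sets P and Q, then no path of U from P
   to Q can be closed up by a path of V.  Indeed the locally constant function c
   equal to 0 on P and to 1 on Q pulls back along a null-homotopy of the loop to
   the square, where c = a - b with a, b locally constant on the preimages of U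
   and V (the square has no first Cech cohomology); following a along the path
   in U and b along the rest of the boundary of the square gives 0 = 1. *)

(** * Locally constant functions on a subset *)

Definition locally_constant_on {T : topologicalType} {S : Type} (D : set T)
    (f : T -> S) : Prop :=
  forall x, D x -> \forall y \near x, D y -> f y = f x.

Lemma locally_constant_onW {T : topologicalType} {S : Type} (D E : set T)
    (f : T -> S) :
  D `<=` E -> locally_constant_on E f -> locally_constant_on D f.
Proof.
by move=> DE lf x /DE /lf; apply: filterS => y fy /DE.
Qed.

Lemma connected_locally_constant {T : topologicalType} {S : Type} (D : set T)
    (f : T -> S) (x y : T) :
  connected D -> locally_constant_on D f -> D x -> D y -> f x = f y.
Proof.
move=> cD lf Dx Dy.
(* Stated as implications, both sets contain the complement of [D], so their interiors in [T] trace
   on [D] the level set of [f x] and its complement, and both traces are relatively open. *)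
pose C := [set z | D z -> f z = f x]; pose C' := [set z | D z -> f z <> f x].
have DC z : D z -> f z = f x -> C° z.
  by move=> Dz fz; rewrite /interior /C /= -fz; exact: lf.
have DC' z : D z -> f z <> f x -> C'° z.
  move=> Dz fz; rewrite /interior /C' /=.
  by apply: filterS (lf z Dz) => w fw Dw; rewrite fw.
have fD : D = D `&` C.
  symmetry; apply: cD; first by exists x.
    exists C°; first exact: open_interior.
    apply/seteqP; split => z [Dz]; first by move=> /(_ Dz) fz; split=> //; apply: DC.
    by move=> /interior_subset Cz; split.
  exists (~` C'°); first by apply: open_closedC; exact: open_interior.
  apply/seteqP; split => z [Dz Cz]; split=> //.
    by move=> /interior_subset nCz; exact: nCz Dz (Cz Dz).
  by move=> _; apply: contrapT => fz; apply: Cz; exact: DC'.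
have [_ /(_ Dy) ->] : (D `&` C) y by rewrite -fD.
by [].
Qed.

Lemma locally_constant_along {R : realType} {T : topologicalType} {S : Type}
    (D : set T) (f : T -> S) (phi : R -> T) (u v : R) :
  continuous phi -> locally_constant_on D f -> u <= v ->
  (forall t, u <= t <= v -> D (phi t)) -> f (phi u) = f (phi v).
Proof.
move=> cphi lf uv Dphi.
pose K := phi @` [set` `[u, v]].
have KD : K `<=` D by move=> _ [t /= + <-]; rewrite in_itv /=; exact: Dphi.
have cK : connected K.
  apply: connected_continuous_connected; first exact: segment_connected.
  exact: continuous_subspaceT.
apply: (connected_locally_constant _ _ _ _ cK (locally_constant_onW _ _ _ KD lf)).
  by exists u => //=; rewrite in_itv /= lexx.
by exists v => //=; rewrite in_itv /= lexx uv.
Qed.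

(** * Cech cohomology of the unit square for a cover by two open sets *)

(** Compactness of a segment in the form of an induction. If [c] is the supremum of the [s] with
    [P a s], the local hypothesis at [c] carries [P a] from some [s] close to [c] to a point beyond
    [c], unless [c] is already [b]. *)
Lemma interval_induction {R : realType} (P : R -> R -> Prop) (a b : R) :
  a <= b ->
  (forall x y z, a <= x -> x <= y -> y <= z -> z <= b ->
    P x y -> P y z -> P x z) ->
  (forall t, a <= t <= b -> exists2 e, 0 < e & forall x y,
    a <= x -> x <= y -> y <= b -> `|t - x| < e -> `|t - y| < e -> P x y) ->
  P a b.
Proof.
move=> ab Ptrans Ploc.
pose E := [set s | a <= s <= b /\ P a s].
have Ea : E a.
  split; first by rewrite lexx.
  have /Ploc[e e0 ePa] : a <= a <= b by rewrite lexx.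
  by apply: ePa; rewrite ?subrr ?normr0.
have Eb : ubound E b by move=> s [/andP[]].
have Esup : has_sup E by split; [exists a | exists b].
set c := sup E.
have Ec : ubound E c by apply: ub_le_sup; exists b.
have ac : a <= c by exact: Ec.
have cb : c <= b by apply: ge_sup => //; exists a.
have /Ploc[e e0 ePc] : a <= c <= b by rewrite ac.
have [s [/andP[as_ sb] Ps] cs] := sup_adherent e0 Esup.
have sc : s <= c by apply: Ec; split=> //; rewrite as_.
(* This [y] belongs to [E], so [y <= c]; the minimum is then not [c + e / 2], hence it is [b]. *)
pose y := Num.min b (c + e / 2).
have yb : y <= b by rewrite ge_min lexx.
have cy : c <= y by rewrite le_min cb /=; lra.
have yce : y <= c + e / 2 by rewrite ge_min lexx orbT.
have Ey : E y.
  split; first by rewrite yb (le_trans ac).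
  apply: (Ptrans a s) => //; first exact: le_trans cy.
  apply: ePc => //; first exact: le_trans cy.
    by rewrite ger0_norm ?subr_ge0 //; move: cs; rewrite -/c; lra.
  by rewrite ler0_norm ?subr_le0 //; lra.
have yc : y <= c by exact: Ec.
have <- : y = b; last by case: Ey.
have : y < c + e / 2 by apply: le_lt_trans yc _; lra.
rewrite /y; case: (leP b (c + e / 2)) => // _; by rewrite ltxx.
Qed.

(* Says that the Cech 1-cocycle [c] of the cover [U], [V] is a coboundary
   over [A]. *)
Definition splits_on {T : topologicalType} (U V : set T) (c : T -> int)
    (A : set T) : Prop :=
  exists a b : T -> int, [/\ locally_constant_on (A `&` U) a,
    locally_constant_on (A `&` V) b &
    forall z, A z -> U z -> V z -> a z = b z + c z].

(** Inside one member of the cover, [c] is locally constant wherever the other member is met, so it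
    can be absorbed entirely into the function attached to that other member (up to sign) or into
    [a], as the case may be. *)
Lemma splits_on_sub {T : topologicalType} (U V : set T) (c : T -> int)
    (A : set T) :
  locally_constant_on (U `&` V) c -> A `<=` U \/ A `<=` V ->
  splits_on U V c A.
Proof.
move=> lc [AU|AV].
- exists (fun=> 0), (fun z => - c z); split.
  + by move=> x _; apply: nearW.
  + move=> x [Ax Vx]; apply: filterS (lc x (conj (AU _ Ax) Vx)) => y cy [Ay Vy].
    by rewrite cy//; split=> //; apply: AU.
  + by move=> z _ _ _; rewrite addNr.
- exists c, (fun=> 0); split.
  + move=> x [Ax Ux]; apply: filterS (lc x (conj Ux (AV _ Ax))) => y cy [Ay Uy].
    by rewrite cy//; split=> //; apply: AV.
  + by move=> x _; apply: nearW.
  + by move=> z _ _ _; rewrite add0r.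
Qed.

(** Pasting over two closed sets: a point outside one of them has a neighbourhood missing it, so
    only the pieces through the point constrain [h]. *)
Lemma locally_constant_onU {T : topologicalType} {S : Type} (A B U : set T)
    (f g h : T -> S) :
  closed A -> closed B ->
  locally_constant_on (A `&` U) f -> locally_constant_on (B `&` U) g ->
  (forall z, A z -> U z -> h z = f z) -> (forall z, B z -> U z -> h z = g z) ->
  locally_constant_on ((A `|` B) `&` U) h.
Proof.
move=> cA cB lf lg hf hg x [ABx Ux].
have nearA : \forall y \near x, A y -> U y -> h y = h x.
  have [Ax|nAx] := pselect (A x).
    apply: filterS (lf x (conj Ax Ux)) => y fy Ay Uy.
    by rewrite !hf// fy.
  have : nbhs x (~` A) by apply: open_nbhs_nbhs; split=> //; exact: closed_openC.
  by apply: filterS => y nAy /nAy.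
have nearB : \forall y \near x, B y -> U y -> h y = h x.
  have [Bx|nBx] := pselect (B x).
    apply: filterS (lg x (conj Bx Ux)) => y gy By Uy.
    by rewrite !hg// gy.
  have : nbhs x (~` B) by apply: open_nbhs_nbhs; split=> //; exact: closed_openC.
  by apply: filterS => y nBy /nBy.
by apply: filterS2 nearA nearB => y hA hB [[/hA|/hB] hy /hy].
Qed.

(* The two splittings differ on [A `&` B] by a locally constant function, hence
   by a constant. *)
Lemma splits_onU {T : topologicalType} (U V : set T) (c : T -> int)
    (A B : set T) :
  open U -> open V -> U `|` V = setT -> closed A -> closed B ->
  connected (A `&` B) ->
  splits_on U V c A -> splits_on U V c B -> splits_on U V c (A `|` B).
Proof.
move=> oU oV UV cA cB cAB [a1 [b1 [la1 lb1 ab1]]] [a2 [b2 [la2 lb2 ab2]]].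
(* On [A], [B], [U] and [V] together both formulas agree because [c] cancels, so [d] is locally
   constant across the whole of [A]&[B]. *)
pose d z := if `[< U z >] then a1 z - a2 z else b1 z - b2 z.
have dU z : U z -> d z = a1 z - a2 z by move=> Uz; rewrite /d asboolT.
have dV z : A z -> B z -> V z -> d z = b1 z - b2 z.
  move=> Az Bz Vz; rewrite /d; case: asboolP => // Uz.
  by rewrite ab1// ab2//; ring.
have ld : locally_constant_on (A `&` B) d.
  move=> x [Ax Bx].
  have [Ux|Vx] : (U `|` V) x by rewrite UV.
    have nU : nbhs x U by apply: open_nbhs_nbhs.
    near=> y => -[Ay By].
    have Uy : U y by near: y.
    rewrite !dU//; congr (_ - _).
      by apply: (near (la1 x (conj Ax Ux)) y).
    by apply: (near (la2 x (conj Bx Ux)) y).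
  have nV : nbhs x V by apply: open_nbhs_nbhs.
  near=> y => -[Ay By].
  have Vy : V y by near: y.
  rewrite !dV//; congr (_ - _).
    by apply: (near (lb1 x (conj Ax Vx)) y).
  by apply: (near (lb2 x (conj Bx Vx)) y).
have [k dk] : exists k, forall z, A z -> B z -> d z = k.
  have [[w ABw]|nAB] := pselect (A `&` B !=set0).
    by exists (d w) => z Az Bz; apply: (connected_locally_constant _ _ _ _ cAB ld).
  by exists 0 => z Az Bz; exfalso; apply: nAB; exists z.
(* Shifting [a2] and [b2] by the same [k] makes them match [a1] and [b1] on [A]&[B] and leaves the
   difference [c] unchanged. *)
pose glue (f g : T -> int) z := if `[< A z >] then f z else g z + k.
have lshift (D : set T) (f : T -> int) : locally_constant_on D f ->
    locally_constant_on D (fun z => f z + k).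
  by move=> lf x Dx; apply: filterS (lf x Dx) => y fy /fy ->.
have aA z : A z -> U z -> glue a1 a2 z = a1 z by move=> Az; rewrite /glue asboolT.
have aB z : B z -> U z -> glue a1 a2 z = a2 z + k.
  move=> Bz Uz; rewrite /glue; case: asboolP => // Az.
  by rewrite -(dk z Az Bz) dU// addrC subrK.
have bA z : A z -> V z -> glue b1 b2 z = b1 z by move=> Az; rewrite /glue asboolT.
have bB z : B z -> V z -> glue b1 b2 z = b2 z + k.
  move=> Bz Vz; rewrite /glue; case: asboolP => // Az.
  by rewrite -(dk z Az Bz) dV// addrC subrK.
exists (glue a1 a2), (glue b1 b2); split.
- exact: locally_constant_onU cA cB la1 (lshift _ _ la2) aA aB.
- exact: locally_constant_onU cA cB lb1 (lshift _ _ lb2) bA bB.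
- move=> z [Az|Bz] Uz Vz.
    by rewrite aA// bA// ab1.
  by rewrite aB// bB// ab2// addrAC.
Unshelve. all: by end_near.
Qed.

Lemma continuous_pair {T U V : topologicalType} (f : T -> U) (g : T -> V) :
  continuous f -> continuous g -> continuous (fun x => (f x, g x)).
Proof.
move=> cf cg x.
exact: (@cvg_pair _ _ _ _ (nbhs (f x)) (nbhs (g x)) _ _ _ _ _ (cf x) (cg x)).
Qed.

Definition rect {R : realType} (x1 x2 y1 y2 : R) : set (R * R) :=
  [set` `[x1, x2]] `*` [set` `[y1, y2]].

Lemma rectP {R : realType} (x1 x2 y1 y2 : R) (z : R * R) :
  rect x1 x2 y1 y2 z <-> (x1 <= z.1 <= x2) /\ (y1 <= z.2 <= y2).
Proof. by rewrite /rect /setX /= !in_itv /=. Qed.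

Lemma closed_rect {R : realType} (x1 x2 y1 y2 : R) : closed (rect x1 x2 y1 y2).
Proof.
have -> : rect x1 x2 y1 y2 = fst @^-1` [set` `[x1, x2]] `&` snd @^-1` [set` `[y1, y2]].
  by [].
apply: closedI; apply: preimage_closed; try exact: itv_closed.
  by move=> z _; exact: cvg_fst.
by move=> z _; exact: cvg_snd.
Qed.

Lemma connected_vsegment {R : realType} (x y1 y2 : R) : connected (rect x x y1 y2).
Proof.
have -> : rect x x y1 y2 = (fun t => (x, t)) @` [set` `[y1, y2]].
  apply/seteqP; split => [[u v] /rectP /= [/le_anti -> vy]|_ [v vy <-]].
    by exists v => //=; rewrite in_itv.
  by apply/rectP; rewrite /= lexx; move: vy; rewrite /= in_itv.
apply: connected_continuous_connected; first exact: segment_connected.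
by apply: continuous_subspaceT; apply: continuous_pair => t; [exact: cvg_cst|exact: cvg_id].
Qed.

Lemma connected_hsegment {R : realType} (x1 x2 y : R) : connected (rect x1 x2 y y).
Proof.
have -> : rect x1 x2 y y = (fun t => (t, y)) @` [set` `[x1, x2]].
  apply/seteqP; split => [[u v] /rectP /= [ux /le_anti ->]|_ [v vy <-]].
    by exists u => //=; rewrite in_itv.
  by apply/rectP; rewrite /= lexx; move: vy; rewrite /= in_itv.
apply: connected_continuous_connected; first exact: segment_connected.
by apply: continuous_subspaceT; apply: continuous_pair => t; [exact: cvg_id|exact: cvg_cst].
Qed.

(** Two nested interval inductions, on the height and then on the width. Adjacent strips or
    rectangles meet in a segment, which is connected, so [splits_onU] merges them; a small enough
    rectangle lies in [U] or in [V]. *)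
Lemma splits_on_unit_square {R : realType} (U V : set (R * R))
    (c : R * R -> int) :
  open U -> open V -> U `|` V = setT -> locally_constant_on (U `&` V) c ->
  splits_on U V c (rect 0 1 0 1).
Proof.
move=> oU oV UV lc.
apply: (@interval_induction R (fun y1 y2 => splits_on U V c (rect 0 1 y1 y2))).
- exact: ler01.
- move=> y1 y2 y3 _ y12 y23 _ s12 s23.
  have -> : rect 0 1 y1 y3 = rect 0 1 y1 y2 `|` rect 0 1 y2 y3.
    apply/seteqP; split => [z /rectP[z1 z2]|z [] /rectP[z1 z2]].
    + by have [zy|zy] := leP z.2 y2; [left|right]; apply/rectP; split=> //; lra.
    + by apply/rectP; split=> //; lra.
    + by apply/rectP; split=> //; lra.
  apply: splits_onU => //; try exact: closed_rect.
  have -> : rect 0 1 y1 y2 `&` rect 0 1 y2 y3 = rect 0 1 y2 y2.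
    apply/seteqP; split => [z [/rectP[z1 z2] /rectP[_ z3]]|z /rectP[z1 z2]].
      by apply/rectP; split=> //; lra.
    by split; apply/rectP; split=> //; lra.
  exact: connected_hsegment.
move=> t2 _.
(* The admissible height [e] around [t2] is part of the inner property: each rectangle brings its
   own, and merging two takes the minimum. *)
apply: (@interval_induction R (fun x1 x2 => exists2 e, 0 < e &
    forall y1 y2, 0 <= y1 -> y1 <= y2 -> y2 <= 1 -> `|t2 - y1| < e ->
      `|t2 - y2| < e -> splits_on U V c (rect x1 x2 y1 y2))).
- exact: ler01.
- move=> x1 x2 x3 _ x12 x23 _ [e e0 He] [d d0 Hd].
  exists (Num.min e d); first by rewrite lt_min e0.
  move=> y1 y2 y1_0 y12 y2_1; rewrite !lt_min => /andP[y1e y1d] /andP[y2e y2d].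
  have -> : rect x1 x3 y1 y2 = rect x1 x2 y1 y2 `|` rect x2 x3 y1 y2.
    apply/seteqP; split => [z /rectP[z1 z2]|z [] /rectP[z1 z2]].
    + by have [zx|zx] := leP z.1 x2; [left|right]; apply/rectP; split=> //; lra.
    + by apply/rectP; split=> //; lra.
    + by apply/rectP; split=> //; lra.
  apply: splits_onU => //; try exact: closed_rect.
  + have -> : rect x1 x2 y1 y2 `&` rect x2 x3 y1 y2 = rect x2 x2 y1 y2.
      apply/seteqP; split => [z [/rectP[z1 z2] /rectP[z3 _]]|z /rectP[z1 z2]].
        by apply/rectP; split=> //; lra.
      by split; apply/rectP; split=> //; lra.
    exact: connected_vsegment.
  + exact: He.
  + exact: Hd.
move=> t1 _.
have [e e0 eUV] : exists2 e, 0 < e &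
    ball (t1, t2) e `<=` U \/ ball (t1, t2) e `<=` V.
  have [Ut|Vt] : (U `|` V) (t1, t2) by rewrite UV.
    have /nbhs_ballP[e /= e0 eU] : nbhs (t1, t2) U by exact: open_nbhs_nbhs.
    by exists e => //; left.
  have /nbhs_ballP[e /= e0 eV] : nbhs (t1, t2) V by exact: open_nbhs_nbhs.
  by exists e => //; right.
exists e => // x1 x2 x1_0 x12 x2_1 x1e x2e; exists e => // y1 y2 y1_0 y12 y2_1 y1e y2e.
(* Balls of the product are products of intervals, so control of the four side coordinates
   suffices. *)
have sub : rect x1 x2 y1 y2 `<=` ball (t1, t2) e.
  move=> [u v] /rectP[/= u12 v12].
  move: x1e x2e y1e y2e; rewrite !ltr_norml => x1e x2e y1e y2e.
  by split; rewrite /ball /= ltr_norml; lra.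
by apply: splits_on_sub => //; case: eUV => eUV; [left|right]; apply: subset_trans eUV.
Qed.

(** * Paths and local path-connectedness *)

Lemma continuous_within_comp {S T U : topologicalType} (A : set T) (f : T -> U)
    (r : S -> T) :
  {within A, continuous f} -> continuous r -> (forall x, A (r x)) ->
  continuous (f \o r).
Proof.
move=> /subspace_continuousP cf cr Ar x W /(cf _ (Ar x)) fW.
have /cr : nbhs (r x) [set y | A y -> W (f y)] by exact: fW.
by rewrite /= !nbhs_simpl /=; apply: filterS => y /(_ (Ar y)).
Qed.

(** Retraction of the line onto the unit segment; composing with it turns continuity within the
    segment into continuity everywhere. *)
Definition clamp {R : realType} (t : R) : R := Num.max 0 (Num.min 1 t).

Lemma clamp_itv {R : realType} (t : R) : 0 <= clamp t <= 1.
Proof. by rewrite /clamp le_max lexx ge_max ler01 ge_min lexx. Qed.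

Lemma clamp_id {R : realType} (t : R) : 0 <= t <= 1 -> clamp t = t.
Proof. by move=> /andP[t0 t1]; rewrite /clamp min_r// max_r. Qed.

Lemma continuous_clamp {R : realType} : continuous (@clamp R).
Proof.
have ccst (k : R) : continuous (fun _ : R => k) by move=> t; exact: cvg_cst.
have cid : continuous (id : R -> R) by move=> t; exact: cvg_id.
exact: max_fun_continuous (ccst 0) (min_fun_continuous (ccst 1) cid).
Qed.

(** The path is continuous on the whole line and stays in [A] at all times, which avoids subspace
    topologies when paths are reversed and concatenated. *)
Definition joined_in (R : realType) {X : topologicalType} (A : set X) (p q : X)
    : Prop :=
  exists g : R -> X, [/\ continuous g, (forall t, A (g t)), g 0 = p & g 1 = q].

Lemma is_path_in_joined {R : realType} {X : topologicalType} (A : set X)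
    (g : R -> X) (p q : X) : is_path_in A g p q -> joined_in R A p q.
Proof.
move=> [cg [g0 [g1 gA]]]; exists (g \o clamp); split.
- apply: continuous_within_comp cg continuous_clamp _ => t.
  by rewrite /= in_itv /= clamp_itv.
- by move=> t; apply: gA; exists (clamp t) => //=; rewrite in_itv /= clamp_itv.
- by rewrite /= clamp_id// lexx ler01.
- by rewrite /= clamp_id// lexx ler01.
Qed.

Lemma joined_in_sub {R : realType} {X : topologicalType} (A B : set X) (p q : X) :
  A `<=` B -> joined_in R A p q -> joined_in R B p q.
Proof. by move=> AB [g [cg gA g0 g1]]; exists g; split=> // t; exact: AB. Qed.

Lemma joined_in_sym {R : realType} {X : topologicalType} (A : set X) (p q : X) :
  joined_in R A p q -> joined_in R A q p.
Proof.
move=> [g [cg gA g0 g1]]; exists (fun t => g (1 - t)); split => //.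
- move=> t; apply: continuous_comp; last exact: cg.
  by apply: cvgB; [exact: cvg_cst|exact: cvg_id].
- by rewrite subr0.
- by rewrite subrr.
Qed.

Definition concat_path {R : realType} {X : Type} (f g : R -> X) (t : R) : X :=
  if t <= 1 / 2 then f (2 * t) else g (2 * t - 1).

Lemma concat_path_l {R : realType} {X : Type} (f g : R -> X) (t : R) :
  t <= 1 / 2 -> concat_path f g t = f (2 * t).
Proof. by rewrite /concat_path => ->. Qed.

Lemma concat_path_r {R : realType} {X : Type} (f g : R -> X) (t : R) :
  f 1 = g 0 -> 1 / 2 <= t -> concat_path f g t = g (2 * t - 1).
Proof.
move=> fg t2; rewrite /concat_path; case: ifPn => // t2'.
have -> : t = 1 / 2 by lra.
have -> : 2 * (1 / 2) = 1 :> R by lra.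
by rewrite subrr.
Qed.

Lemma continuous_concat_path {R : realType} {X : topologicalType}
    (f g : R -> X) :
  continuous f -> continuous g -> f 1 = g 0 -> continuous (concat_path f g).
Proof.
move=> cf cg fg; set h := concat_path f g.
have cl : {within [set` `]-oo, (1 / 2 : R)]], continuous h}.
  apply: (@subspace_eq_continuous R _ X (fun t : R => f (2 * t)) h).
    by move=> t /set_mem /=; rewrite in_itv /= => t2; rewrite /h concat_path_l.
  apply: continuous_subspaceT => t; apply: continuous_comp; last exact: cf.
  by apply: cvgM; [exact: cvg_cst|exact: cvg_id].
have cr : {within [set` `[(1 / 2 : R), +oo[], continuous h}.
  apply: (@subspace_eq_continuous R _ X (fun t : R => g (2 * t - 1)) h).
    by move=> t /set_mem /=; rewrite in_itv /= andbT => t2; rewrite /h concat_path_r.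
  apply: continuous_subspaceT => t; apply: continuous_comp; last exact: cg.
  by apply: cvgB; [apply: cvgM; [exact: cvg_cst|exact: cvg_id]|exact: cvg_cst].
have := withinU_continuous (@lray_closed _ R _) (@rray_closed _ R _) cl cr.
have -> : [set` `]-oo, (1 / 2 : R)]] `|` [set` `[(1 / 2 : R), +oo[] = setT.
  rewrite -subTset => t _; rewrite /setU /= !in_itv /= andbT.
  by have [|/ltW] := leP t (1 / 2); [left|right].
by move=> ch t; have := ch t; rewrite /continuous_at nbhs_subspaceT.
Qed.

Lemma joined_in_trans {R : realType} {X : topologicalType} (A : set X)
    (p q r : X) :
  joined_in R A p q -> joined_in R A q r -> joined_in R A p r.
Proof.
move=> [f [cf fA f0 f1]] [g [cg gA g0 g1]].
exists (concat_path f g); split.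
- by apply: continuous_concat_path => //; rewrite f1.
- by move=> t; rewrite /concat_path; case: ifP.
- by rewrite concat_path_l ?mulr0 //; lra.
- by rewrite concat_path_r ?f1 //; [rewrite -g1; congr g|]; lra.
Qed.

Lemma locally_path_connected_near_joined {R : realType} {X : topologicalType}
    (W : set X) (x : X) :
  locally_path_connected R X -> nbhs x W ->
  \forall y \near x, joined_in R W x y.
Proof.
move=> lpc /lpc[V [Vx VW pV]]; apply: filterS (Vx) => y Vy.
have [g pg] := pV _ _ (nbhs_singleton Vx) Vy.
by apply: joined_in_sub VW _; exact: is_path_in_joined pg.
Qed.

(** Being joined to [x] inside [W] is a locally constant [Prop]-valued function on [B], since nearby
    points are joined in the open set [W]. The path may leave [B], so the lemma also serves for a
    closed [B]. *)
Lemma connected_joined_in {R : realType} {X : topologicalType} (B W : set X)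
    (x y : X) :
  locally_path_connected R X -> connected B -> open W -> B `<=` W ->
  B x -> B y -> joined_in R W x y.
Proof.
move=> lpc cB oW BW Bx By.
have nearW b : B b -> \forall z \near b, joined_in R W b z.
  move=> Bb; apply: locally_path_connected_near_joined => //.
  by apply: open_nbhs_nbhs; split=> //; exact: BW.
have <- : joined_in R W x x = joined_in R W x y.
  apply: (connected_locally_constant _ _ _ _ cB) => // b Bb.
  apply: filterS (nearW b Bb) => z bz _; apply/propext; split => xz.
    by apply: joined_in_trans xz _; exact: joined_in_sym.
  exact: joined_in_trans bz.
exact: nbhs_singleton (nearW x Bx).
Qed.

(** * Simple connectedness and covers by two open sets *)

Lemma simply_connected_open_cover {R : realType} {X : topologicalType}
    (U V P Q : set X) (p q : X) :
  simply_connected R X -> open U -> open V -> U `|` V = setT ->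
  open P -> open Q -> P `&` Q = set0 -> U `&` V `<=` P `|` Q ->
  P p -> Q q -> joined_in R U p q -> joined_in R V q p -> False.
Proof.
move=> [_ sc] oU oV UV oP oQ PQ UVPQ Pp Qq [f [cf fU f0 f1]] [g [cg gV g0 g1]].
have fg : f 1 = g 0 by rewrite f1.
set h := concat_path f g.
have h0 : h 0 = p by rewrite /h concat_path_l ?mulr0//; lra.
have h1 : h 1 = p.
  by rewrite /h concat_path_r//; [rewrite -g1; congr g|]; lra.
have ch : continuous h by exact: continuous_concat_path.
have [||H [cH H0 H1 HL]] := sc h; first exact: continuous_subspaceT.
  by rewrite h0.
(* Retracting the plane onto the square makes the null-homotopy a continuous map [G] on the whole
   plane. *)
pose r (z : R * R) := (clamp z.1, clamp z.2).
have cr : continuous r.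
  apply: (@continuous_pair _ _ _ (clamp \o fst) (clamp \o snd)) => z.
    by apply: continuous_comp; [exact: cvg_fst|exact: continuous_clamp].
  by apply: continuous_comp; [exact: cvg_snd|exact: continuous_clamp].
pose G := H \o r.
have cG : continuous G.
  apply: continuous_within_comp cH cr _ => z.
  by split; rewrite /= in_itv /= clamp_itv.
pose c x : int := if `[< Q x >] then 1 else 0.
have lc : locally_constant_on (G @^-1` U `&` G @^-1` V) (c \o G).
  move=> z [Uz Vz].
  have [Pz|Qz] := UVPQ _ (conj Uz Vz).
    have : nbhs z (G @^-1` P) by apply: cG; exact: open_nbhs_nbhs.
    have nQ x : P x -> ~ Q x by move=> Px Qx; rewrite -[False]/(set0 x) -PQ.
    by apply: filterS => w Pw _; rewrite /c /= !asboolF//; exact: nQ.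
  have : nbhs z (G @^-1` Q) by apply: cG; exact: open_nbhs_nbhs.
  by apply: filterS => w Qw _; rewrite /c /= !asboolT.
have [||||a [b [la lb ab]]] := splits_on_unit_square (G @^-1` U) (G @^-1` V) (c \o G).
- by apply: open_comp => // z _; exact: cG.
- by apply: open_comp => // z _; exact: cG.
- by rewrite -subTset => z _; have : (U `|` V) (G z) by rewrite UV.
- exact: lc.
have Gb s : 0 <= s <= 1 -> G (s, 0) = h s.
  by move=> s01; rewrite /G /r /= clamp_id// clamp_id ?lexx ?ler01// H0// in_itv.
have Gt s : 0 <= s <= 1 -> G (s, 1) = p.
  by move=> s01; rewrite /G /r /= clamp_id// clamp_id ?lexx ?ler01// H1// in_itv.
have Gl t : 0 <= t <= 1 -> G (0, t) = p.
  move=> t01; rewrite /G /r /= clamp_id ?lexx ?ler01// clamp_id//.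
  by have [] := HL t; rewrite ?in_itv// h0.
have Gr t : 0 <= t <= 1 -> G (1, t) = p.
  move=> t01; rewrite /G /r /= clamp_id ?lexx ?ler01// clamp_id//.
  by have [] := HL t; rewrite ?in_itv// h0.
have Up : U p by rewrite -f0.
have Vp : V p by rewrite -g1.
have Uq : U q by rewrite -f1.
have Vq : V q by rewrite -g0.
have hh : h (1 / 2) = q.
  by rewrite /h concat_path_l//; rewrite -f1; congr f; lra.
have chor (y : R) : continuous (fun s : R => (s, y)).
  by apply: (@continuous_pair _ _ _ id (fun=> y)) => t; [exact: cvg_id|exact: cvg_cst].
have cver (x : R) : continuous (fun s : R => (x, s)).
  by apply: (@continuous_pair _ _ _ (fun=> x) id) => t; [exact: cvg_cst|exact: cvg_id].
(* The first half of the bottom side follows [f] inside [U], and its second half follows [g] inside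
   [V]; on the three other sides [G] is constantly [p], which lies in [V]. *)
have a_bot : a (0, 0) = a (1 / 2, 0).
  apply: (locally_constant_along _ _ _ _ _ (chor 0) la) => [|t t2]; first lra.
  split; first by apply/rectP => /=; lra.
  by rewrite /= Gb ?/h ?concat_path_l//; lra.
have b_bot : b (1 / 2, 0) = b (1, 0).
  apply: (locally_constant_along _ _ _ _ _ (chor 0) lb) => [|t t2]; first lra.
  split; first by apply/rectP => /=; lra.
  by rewrite /= Gb ?/h ?concat_path_r//; lra.
have b_left : b (0, 0) = b (0, 1).
  apply: (locally_constant_along _ _ _ _ _ (cver 0) lb) => [|t t2]; first lra.
  by split; [apply/rectP => /=; lra|rewrite /= Gl].
have b_top : b (0, 1) = b (1, 1).
  apply: (locally_constant_along _ _ _ _ _ (chor 1) lb) => [|t t2]; first lra.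
  by split; [apply/rectP => /=; lra|rewrite /= Gt].
have b_right : b (1, 0) = b (1, 1).
  apply: (locally_constant_along _ _ _ _ _ (cver 1) lb) => [|t t2]; first lra.
  by split; [apply/rectP => /=; lra|rewrite /= Gr].
have c0 : a (0, 0) = b (0, 0).
  have G00 : G (0, 0) = p by rewrite Gl ?lexx ?ler01.
  rewrite ab /= ?G00//; last by apply/rectP => /=; lra.
  by rewrite /c asboolF ?addr0// => Qp; rewrite -[False]/(set0 p) -PQ.
have c1 : a (1 / 2, 0) = b (1 / 2, 0) + 1.
  have Gq : G (1 / 2, 0) = q by rewrite Gb ?hh//; lra.
  rewrite ab /= ?Gq//; last by apply/rectP => /=; lra.
  by rewrite /c asboolT.
(* Around the boundary of the square, [b] takes the same value at [(1 / 2, 0)] and [(0, 0)], as does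
   [a]; but [a - b] is 1 at the former and 0 at the latter. *)
lia.
Qed.

(** * Boundaries, closed separations and unicoherence *)

Lemma boundary_open {X : topologicalType} (U : set X) :
  open U -> boundary U = closure U `\` U.
Proof. by move=> oU; rewrite /boundary (interior_id U).1. Qed.

Lemma boundary_closed {X : topologicalType} (A : set X) :
  closed A -> boundary A = A `\` A°.
Proof. by move=> cA; rewrite /boundary -(closure_id A).1. Qed.

Lemma closed_boundary {X : topologicalType} (A : set X) : closed (boundary A).
Proof.
rewrite /boundary setDE; apply: closedI; first exact: closed_closure.
by apply: open_closedC; exact: open_interior.
Qed.

Lemma boundary_setC {X : topologicalType} (A : set X) :
  boundary (~` A) = boundary A.
Proof.
have cA : ~` A° = closure (~` A) by rewrite -{1}(setCK A) interiorC setCK.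
by rewrite /boundary !setDE cA interiorC setCK setIC.
Qed.

Lemma connected_clopen {X : topologicalType} (A B : set X) :
  connected [set: X] -> closed A -> closed B -> A `|` B = setT ->
  A `&` B = set0 -> A !=set0 -> B !=set0 -> False.
Proof.
move=> cX cA cB AB AB0 A0 [y By].
have BA : ~` B = A.
  apply/seteqP; split => x; last by move=> Ax Bx; rewrite -[False]/(set0 x) -AB0.
  by move=> nBx; have [] : (A `|` B) x by rewrite AB.
have AT : A = setT.
  apply: cX => //; last by exists A; rewrite ?setTI.
  by exists A; rewrite ?setTI// -BA; exact: closed_openC.
by rewrite -[False]/(set0 y) -AB0 AT.
Qed.

(** A limit point of [A] stays in the closed union, and separation keeps it out of [B]. *)
Lemma separated_closed {X : topologicalType} (A B : set X) :
  closed (A `|` B) -> separated A B -> closed A.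
Proof.
move=> cAB [AB _] x Ax.
have : (A `|` B) x by apply: cAB; move: x Ax; apply: closureS => x; left.
by case=> // Bx; have : set0 x by rewrite -AB.
Qed.

Lemma closed_not_connectedP {X : topologicalType} (D : set X) :
  closed D -> ~ connected D -> exists A B : set X,
    [/\ closed A, closed B, A !=set0, B !=set0 &
        D = A `|` B /\ A `&` B = set0].
Proof.
move=> cD /connectedPn[E [E0 DE sE]]; exists (E false), (E true).
split; [| |exact: E0|exact: E0|].
- by apply: separated_closed sE; rewrite -DE.
- by apply: (@separated_closed _ _ (E false)); rewrite 1?separatedC// setUC -DE.
- by split=> //; exact: separated_disjoint.
Qed.

Lemma connected_sub_closedU {X : topologicalType} (A B C : set X) :
  closed A -> closed B -> A `&` B = set0 -> connected C -> C `<=` A `|` B ->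
  C `<=` A \/ C `<=` B.
Proof.
move=> cA cB AB cC CAB; apply: connected_subset cC => //.
by split; [rewrite -(closure_id A).1|rewrite -(closure_id B).1].
Qed.

(* If the boundary were a disjoint union of closed sets [A] and [B], with
   disjoint neighbourhoods [NA] and [NB], the complement of [U] would sit inside
   the open set [V] below, and [U] and [V] would meet in [NA] and [NB] only. *)
Lemma connected_boundary {R : realType} {X : metricType R} (U : set X) :
  simply_connected R X -> locally_path_connected R X ->
  open U -> connected U -> connected (~` U) -> connected (boundary U).
Proof.
move=> sc lpc oU cU cCU; apply: contrapT.
move=> /(closed_not_connectedP _ (closed_boundary U)).
move=> [A [B [cA cB [x Ax] [y By] [UAB AB]]]].
have /(@normal_openP R) nX : normal_space X by exact: (@pseudometric_normal R).
have [NA [NB [oA oB AN BN NAB]]] := nX _ _ cA cB AB.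
pose V := ~` closure U `|` (NA `|` NB).
have oV : open V.
  apply: openU; last exact: openU.
  by apply: closed_openC; exact: closed_closure.
have UV : ~` U `<=` V.
  move=> z nUz; have [Uz|] := pselect (closure U z); last by left.
  have : boundary U z by rewrite boundary_open.
  by rewrite UAB => -[/AN|/BN] Nz; right; [left|right].
have bU z : boundary U z -> closure U z /\ ~ U z by rewrite boundary_open.
have [Ux nUx] : closure U x /\ ~ U x by apply: bU; rewrite UAB; left.
have [Uy nUy] : closure U y /\ ~ U y by apply: bU; rewrite UAB; right.
(* The boundary points [x] and [y] lie outside the open set [U]; they are replaced by nearby points
   [p] and [q] of [U], reached without leaving [NA] and [NB]. *)
have near_pt (N : set X) z : open N -> N z -> closure U z ->
    exists2 p, joined_in R N z p & U p /\ N p.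
  move=> oN Nz Uz.
  have nN : nbhs z N by exact: open_nbhs_nbhs.
  have [p [Up [jp Np]]] := Uz _ (filterI (locally_path_connected_near_joined _ _ lpc nN) nN).
  by exists p.
have [p xp [Up Np]] := near_pt _ _ oA (AN _ Ax) Ux.
have [q yq [Uq Nq]] := near_pt _ _ oB (BN _ By) Uy.
apply: (@simply_connected_open_cover R X U V NA NB p q) => //.
- by rewrite -subTset => z _; have [|/UV] := pselect (U z); [left|right].
- by move=> z [Uz [/(_ (subset_closure Uz))|]].
- exact: (@connected_joined_in R X U U).
(* The return path in [V] goes from [q] to [y] in [NB], from [y] to [x] along the connected
   complement of [U], then from [x] to [p] in [NA]. *)
- apply: (@joined_in_trans _ _ _ _ y).
    by apply: joined_in_sym; apply: joined_in_sub yq => z; right; right.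
  apply: (@joined_in_trans _ _ _ _ x).
    exact: (@connected_joined_in R X (~` U) V).
  by apply: joined_in_sub xp => z; right; left.
Qed.

(** Near a point of one set the other is absent, being closed and disjoint from it, so interior
    points of the union are interior to that one set. *)
Lemma boundary_setU_closed {X : topologicalType} (A B : set X) :
  closed A -> closed B -> A `&` B = set0 ->
  boundary (A `|` B) = boundary A `|` boundary B.
Proof.
move=> cA cB AB.
have side (C D : set X) x : closed D -> C `&` D = set0 -> C x ->
    ~ (C°) x -> ~ ((C `|` D)°) x.
  move=> cD CD Cx + CDx; apply.
  have nD : nbhs x (~` D).
    apply: open_nbhs_nbhs; split; first exact: closed_openC.
    by move=> Dx; have : set0 x by rewrite -CD.
  by apply: filterS2 CDx nD => z [].
rewrite !boundary_closed//; last exact: closedU.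
apply/seteqP; split => x.
  move=> [[Ax|Bx] nABx]; [left|right]; split=> //; apply: contra_not nABx.
    by apply: interiorS; exact: subsetUl.
  by apply: interiorS; exact: subsetUr.
move=> [[Ax nAx]|[Bx nBx]]; split; [by left|exact: side|by right|].
by rewrite setUC; apply: side => //; rewrite setIC.
Qed.

(** A closed set with empty boundary is also open, which connectedness forbids here. *)
Lemma boundary_neq0 {X : topologicalType} (A : set X) :
  connected [set: X] -> closed A -> A !=set0 -> ~` A !=set0 ->
  boundary A !=set0.
Proof.
move=> cX cA A0 nA0; apply: contrapT => /nonemptyPn bA.
have oA : open A.
  rewrite openE => x Ax; apply: contrapT => nAx.
  by rewrite -[False]/(set0 x) -bA boundary_closed.
apply: (@connected_clopen _ A (~` A)) => //.
- exact: open_closedC.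
- exact: setUv.
- exact: setICr.
Qed.

Lemma closed_OmegaBar {X : topologicalType} {q : nat} (Om : 'I_q -> set X)
    (K : {set 'I_q}) : closed (OmegaBar Om K).
Proof.
have -> : OmegaBar Om K = \bigcup_(i in [set` K]) closure (Om i) by [].
by apply: closed_bigcup => // i _; exact: closed_closure.
Qed.

(** * Combinatorics of the tiles *)

Section tiling.
Context {X : topologicalType} {q : nat} {Om : 'I_q -> set X}.
Hypotheses (Hopen : forall i, open (Om i))
  (Hne : forall i, Om i !=set0)
  (Hdisj : forall i j, i != j -> Om i `&` Om j = set0)
  (Hcover : \bigcup_i closure (Om i) = [set: X])
  (Hconn : forall i, connected (Om i))
  (Hreg : forall i, Om i = (closure (Om i))°).

Lemma tile_disjoint_closure (i j : 'I_q) :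
  i != j -> Om i `&` closure (Om j) = set0.
Proof.
move=> ij; rewrite -subset0 => x [xi /(_ (Om i))].
have nx : nbhs x (Om i) by exact: open_nbhs_nbhs.
by move=> /(_ nx); rewrite setIC Hdisj// => -[].
Qed.

(** A point in no other closed tile has a neighbourhood missing all of them, their finite union
    being closed. The closure of [Om l] must cover this neighbourhood, and regularity puts the point
    in [Om l]. *)
Lemma tile_setC (l : 'I_q) (x : X) :
  ~ Om l x -> exists2 i, i != l & closure (Om i) x.
Proof.
move=> nx; apply: contrapT => nex; apply: nx.
have nx : nbhs x (~` OmegaBar Om [set~ l]%SET).
  apply: open_nbhs_nbhs; split; first by apply: closed_openC; exact: closed_OmegaBar.
  by move=> [i]; rewrite !inE => il xi; apply: nex; exists i.
rewrite Hreg; apply: filterS (nx) => y ny.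
have [i _ yi] : (\bigcup_i closure (Om i)) y by rewrite Hcover.
have [<-//|il] := eqVneq i l.
by exfalso; apply: ny; exists i => //; rewrite !inE.
Qed.

Lemma exists_disconnecting_tile :
  connected [set: X] -> (forall l, connected (~` Om l) -> connected (boundary (Om l))) ->
  ~ connected (\bigcup_i boundary (Om i)) -> exists l, ~ connected (~` Om l).
Proof.
move=> cX cbd nS; apply: contrapT => /forallNP nl.
have {}cbd l : connected (boundary (Om l)) by apply: cbd; exact: contrapT (nl l).
have cS : closed (\bigcup_i boundary (Om i)).
  apply: closed_bigcup => [|i _]; last exact: closed_boundary.
  exact: finite_finset.
have [A [B [cA cB [x Ax] [y By] [SAB AB]]]] := closed_not_connectedP _ cS nS.
have sAB i : boundary (Om i) `<=` A \/ boundary (Om i) `<=` B.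
  by apply: connected_sub_closedU => //; rewrite -SAB => z zi; exists i.
have AB' z : A z -> B z -> False by move=> Az Bz; rewrite -[False]/(set0 z) -AB.
pose K := [set i | `[< boundary (Om i) `<=` A >]]%SET.
have [i _ xi] : (\bigcup_i boundary (Om i)) x by rewrite SAB; left.
have [j _ yj] : (\bigcup_i boundary (Om i)) y by rewrite SAB; right.
apply: (@connected_clopen _ (OmegaBar Om K) (OmegaBar Om (~: K)%SET)) => //;
  try exact: closed_OmegaBar.
- rewrite -subTset => z _.
  have [k _ zk] : (\bigcup_i closure (Om i)) z by rewrite Hcover.
  by have [kK|kK] := boolP (k \in K); [left|right]; exists k; rewrite ?finset.in_setC.
- rewrite -subset0 => z [[k kK zk] [m mK zm]].
  (* A common point of the closures of two distinct tiles lies in neither tile, hence in both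
     boundaries; here one boundary is in [A] and the other in [B]. *)
  have km : k != m by apply: contraTneq kK => ->; move: mK; rewrite finset.in_setC.
  have bk : boundary (Om k) z.
    rewrite boundary_open//; split=> // zOk.
    by have : (Om k `&` closure (Om m)) z by []; rewrite tile_disjoint_closure.
  have bm : boundary (Om m) z.
    rewrite boundary_open//; split=> // zOm.
    by have : (Om m `&` closure (Om k)) z by []; rewrite tile_disjoint_closure// eq_sym.
  move: kK mK; rewrite finset.in_setC !inE => kA /asboolPn mA.
  by have [/mA//|mB] := sAB m; exfalso; apply: (AB' z (kA z bk)); exact: mB.
- exists x; exists i; last by case: xi.
  rewrite inE; apply/asboolP; have [//|iB] := sAB i.
  by exfalso; apply: (AB' x) => //; exact: iB.
- exists y; exists j; last by case: yj.
  by rewrite finset.in_setC inE; apply/asboolP => jA; apply: (AB' y) => //; exact: jA.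
Qed.

(** The closure of a tile is connected and, for a tile other than [Om l], avoids [Om l]; it cannot
    straddle the separation. *)
Lemma closure_tile_sub (l i : 'I_q) (A B : set X) :
  closed A -> closed B -> ~` Om l = A `|` B -> A `&` B = set0 -> i != l ->
  closure (Om i) `<=` A \/ closure (Om i) `<=` B.
Proof.
move=> cA cB lAB AB il.
apply: connected_sub_closedU => //; first exact: connected_closure.
rewrite -lAB => z zi zl.
by have : (Om l `&` closure (Om i)) z by []; rewrite tile_disjoint_closure// eq_sym.
Qed.

(** A point of [A] is outside [Om l], so it lies in the closure of another tile, and that closure
    cannot be on the side of [B]. *)
Lemma OmegaBar_sub (l : 'I_q) (A B : set X) :
  closed A -> closed B -> ~` Om l = A `|` B -> A `&` B = set0 ->
  let I := [set i | (i != l) && `[< closure (Om i) `<=` A >]]%SET in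
  OmegaBar Om I = A.
Proof.
move=> cA cB lAB AB I; apply/seteqP; split => x.
  by move=> [i]; rewrite inE => /andP[_ iA]; exact: (asboolW iA).
move=> Ax; have [i il xi] : exists2 i, i != l & closure (Om i) x.
  by apply: tile_setC; rewrite -[~ _]/((~` Om l) x) lAB; left.
exists i => //; rewrite inE il /=; apply/asboolP.
have [//|iB] := closure_tile_sub l i A B cA cB lAB AB il.
by exfalso; rewrite -[False]/(set0 x) -AB; split=> //; exact: iB.
Qed.

End tiling.

Theorem theorem1p5 (R : realType) (X : metricType R) (q : nat)
  (Om : 'I_q -> set X)
  (HXconn : connected [set: X])
  (HXsc : simply_connected R X)
  (HXlpc : locally_path_connected R X)
  (Hopen : forall i, open (Om i))
  (Hne : forall i, Om i !=set0)
  (Hdisj : forall i j, i != j -> Om i `&` Om j = set0)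
  (Hcover : \bigcup_i closure (Om i) = [set: X])
  (Hconn : forall i, connected (Om i))
  (Hreg : forall i, Om i = (closure (Om i))°)
  (HSigma : ~ connected (\bigcup_i boundary (Om i))) :
  exists (I J : {set 'I_q}) (l : 'I_q),
    [/\ [/\ I != finset.set0, J != finset.set0, (I :&: J)%SET == finset.set0, l \notin I & l \notin J],
        (I :|: J :|: [set l] = [set: 'I_q])%SET,
        [/\ OmegaBar Om I `|` Om l `|` OmegaBar Om J = [set: X],
            OmegaBar Om I `&` Om l = set0,
            Om l `&` OmegaBar Om J = set0 &
            OmegaBar Om I `&` OmegaBar Om J = set0] &
        [/\ boundary (Om l) = boundary (OmegaBar Om I) `|` boundary (OmegaBar Om J),
            boundary (OmegaBar Om I) `&` boundary (OmegaBar Om J) = set0,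
            boundary (OmegaBar Om I) !=set0 &
            boundary (OmegaBar Om J) !=set0]].
Proof.
have [l ncl] : exists l, ~ connected (~` Om l).
  apply: (exists_disconnecting_tile Hopen Hdisj Hcover HXconn _ HSigma) => l.
  exact: (@connected_boundary R).
have cl : closed (~` Om l) by exact: open_closedC.
have [A [B [cA cB A0 B0 [lAB AB]]]] := closed_not_connectedP _ cl ncl.
(* The separation with its sides exchanged, so that [OmegaBar_sub] also identifies [B]. *)
have lBA : ~` Om l = B `|` A by rewrite setUC.
have BA : B `&` A = set0 by rewrite setIC.
have nA : ~` A !=set0.
  by case: B0 => y By; exists y => Ay; rewrite -[False]/(set0 y) -AB.
have nB : ~` B !=set0.
  by case: A0 => y Ay; exists y => By; rewrite -[False]/(set0 y) -AB.
have lA : A `&` Om l = set0.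
  rewrite -subset0 => x [Ax lx].
  by have : (~` Om l) x by rewrite lAB; left.
have lB : Om l `&` B = set0.
  rewrite -subset0 => x [lx Bx].
  by have : (~` Om l) x by rewrite lAB; right.
pose I := [set i | (i != l) && `[< closure (Om i) `<=` A >]]%SET.
pose J := [set i | (i != l) && `[< closure (Om i) `<=` B >]]%SET.
have IA : OmegaBar Om I = A.
  exact: (OmegaBar_sub Hopen Hdisj Hcover Hconn Hreg l A B).
have JB : OmegaBar Om J = B.
  exact: (OmegaBar_sub Hopen Hdisj Hcover Hconn Hreg l B A).
exists I, J, l; rewrite IA JB; split.
- split.
  + by apply/eqP => I0; case: A0 => x; rewrite -IA I0 => -[i]; rewrite finset.in_set0.
  + by apply/eqP => J0; case: B0 => x; rewrite -JB J0 => -[i]; rewrite finset.in_set0.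
  (* An index in both sets would give a non-empty tile contained in both [A] and [B]. *)
  + apply/eqP/finset.setP => i; rewrite finset.in_setI finset.in_set0.
    apply/negP => /andP[]; rewrite !finset.in_set => /andP[_ iA] /andP[_ iB].
    have [x /subset_closure xi] := Hne i.
    have : (A `&` B) x by split; [exact: asboolW iA x xi|exact: asboolW iB x xi].
    by rewrite AB.
  + by rewrite finset.in_set eqxx.
  + by rewrite finset.in_set eqxx.
- apply/finset.setP => i; rewrite !finset.in_setU finset.in_set1 finset.in_setT !finset.in_set.
  have [->|il] := eqVneq i l; first by rewrite orbT.
  have [iA|iB] := closure_tile_sub Hopen Hdisj Hconn l i A B cA cB lAB AB il.
    by rewrite asboolT.
  by rewrite (asboolT iB) orbT.
- split=> //; rewrite -(setvU (Om l)) lAB.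
  by rewrite setUAC.
- split.
  (* The boundary of [Om l] is that of its complement, the disjoint union of the closed sets [A] and
     [B]. *)
  + by rewrite -boundary_setC lAB boundary_setU_closed.
  + rewrite !boundary_closed// -subset0 => x [[Ax _] [Bx _]].
    by rewrite -AB.
  + exact: boundary_neq0.
  + exact: boundary_neq0.
Qed.
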